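(* Let $n\in\mathbb{N}_0=\{0,1,2,\ldots\}$ and let $x$ be real with $|x|\le 1$. Then $$D_n(2x,1)=2C_n\big(x,\sqrt{1-x^2}\big)=2\,\mathrm{Re}\big\{N_n\big(x+i\sqrt{1-x^2}\big)\big\}.$$
   Context: The Dickson polynomials of the first kind $D_n(x,\alpha)$ ($\alpha$ a real parameter) are given by $\frac{2-xt}{1-xt+\alpha t^2}=\sum_{n\ge0}D_n(x,\alpha)t^n$. The polynomials $C_n(x,y)$ are defined by $e^{xt}\cos(yt)=\sum_{n\ge0}C_n(x,y)\frac{t^n}{n!}$. For $w=x+iy$ with $x,y\in\mathbb{R}$, also written $(x,y)$, the polynomials $N_n(w)$ are defined by $\exp(wt)=\sum_{n\ge0}N_n(w)\frac{t^n}{n!}$. *)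

(* Defs.v *)
From Stdlib Require Import Reals Factorial.
From Coquelicot Require Import Coquelicot.
Open Scope R_scope.

(* The three families of polynomials are characterised by their generating
   functions.  Each predicate determines the family completely, since a
   function given near 0 by a convergent power series determines the
   coefficients; in particular the values are necessarily polynomial in the
   arguments. *)

(* The generating function is rational, with poles depending on [x] and
   [alpha]; the expansion holds for [t] in a neighbourhood of [0]. *)
Definition dickson_first_kind (D : nat -> R -> R -> R) : Prop :=
  forall x alpha : R,
    locally 0 (fun t : R =>
      is_pseries (fun n => D n x alpha) t
        ((2 - x * t) / (1 - x * t + alpha * t ^ 2))).

(* The generating functions below are entire, so the expansions hold for every
   real [t]. *)
Definition exp_cos_family (Cn : nat -> R -> R -> R) : Prop :=
  forall x y t : R,
    is_pseries (fun n => Cn n x y / INR (fact n)) t (exp (x * t) * cos (y * t)).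

Definition Cexp (z : C) : C :=
  (exp (Re z) * cos (Im z), exp (Re z) * sin (Im z)).

(* [t] is real, so the series is one in the real normed space [C]. *)
Definition exp_family (N : nat -> C -> C) : Prop :=
  forall (w : C) (t : R),
    is_pseries (K := R_AbsRing) (V := C_R_NormedModule)
      (fun n => N n w / RtoC (INR (fact n)))%C t (Cexp (w * RtoC t)%C).

(* Main.v *)
(** With [x = cos θ], both families take the values [2 cos (n θ)].  Each
   differentiation of [exp (x t) cos (y t)], where [y = sin θ], adds [θ] to the
   phase of the cosine, so [C_n (x, y) = cos (n θ)] at [t = 0].  Clearing the
   denominator of the Dickson generating function gives
   [D_(n+2) = 2 x D_(n+1) - D_n], which [2 cos (n θ)] satisfies as well.  The
   second equality is the real part of the series defining [N_n]. *)
Require Import Defs.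
From Stdlib Require Import Reals Factorial Lra.
From Coquelicot Require Import Coquelicot.
Open Scope R_scope.

(** Convergence at the single point [eps / 2] makes the terms tend to 0 there, which is impossible
    strictly outside the disk of convergence. *)
Lemma CV_radius_pos_of_locally (a : nat -> R) (f : R -> R) :
  locally 0 (fun t : R => is_pseries a t (f t)) -> Rbar_lt 0 (CV_radius a).
Proof.
intros [eps Heps].
pose proof (cond_pos eps) as He.
apply Rbar_lt_le_trans with (Finite (Rabs (eps / 2))).
  simpl; rewrite Rabs_pos_eq; lra.
apply Rbar_not_lt_le; intros Hlt.
apply (CV_disk_outside _ _ Hlt).
apply ex_series_lim_0.
exists (f (eps / 2)).
apply is_pseries_R, Heps.
change (Rabs (eps / 2 - 0) < eps).
rewrite Rabs_pos_eq; lra.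
Qed.

(** Uniqueness of Taylor coefficients: this turns identities between generating functions near 0
    into identities between coefficients. *)
Lemma pseries_coef_Derive_n (a : nat -> R) (f : R -> R) (n : nat) :
  locally 0 (fun t : R => is_pseries a t (f t)) ->
  a n * INR (fact n) = Derive_n f n 0.
Proof.
intros H.
rewrite <- (Derive_n_coef a n (CV_radius_pos_of_locally a f H)).
apply Derive_n_ext_loc.
revert H; apply filter_imp; intros t Ht.
now apply is_pseries_unique.
Qed.

Lemma Derive_n_iterated (F : nat -> R -> R) :
  (forall (k : nat) (t : R), is_derive (F k) t (F (S k) t)) ->
  forall n t, Derive_n (F 0%nat) n t = F n t.
Proof.
intros HF; induction n as [|n IH]; intros t; [reflexivity|].
simpl; rewrite (Derive_ext _ _ t IH).
now apply is_derive_unique.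
Qed.

Lemma Derive_n_affine (a b : R) (n : nat) :
  Derive_n (fun t => a + b * t) n 0 =
  match n with 0%nat => a | 1%nat => b | _ => 0 end.
Proof.
pose (F := fun k t =>
  match k with 0%nat => a + b * t | 1%nat => b | _ => 0 end).
change (Derive_n (F 0%nat) n 0 =
  match n with 0%nat => a | 1%nat => b | _ => 0 end).
rewrite Derive_n_iterated.
  destruct n as [|[|n]]; simpl; ring.
intros [|[|k]] t; unfold F; auto_derive; trivial; ring.
Qed.

Lemma dickson_rec (D : nat -> R -> R -> R) (x alpha : R) :
  dickson_first_kind D ->
  D 0%nat x alpha = 2 /\ D 1%nat x alpha = x /\
  forall n, D (S (S n)) x alpha = x * D (S n) x alpha - alpha * D n x alpha.
Proof.
intros HD.
pose (a := fun n => D n x alpha).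
(* [PS_incr_1] multiplies a series by [t], so [b] holds the coefficients of [1 - x t + alpha t^2]
   times the series of [a]. Its sum is the numerator [2 - x t]. *)
pose (b := PS_plus a (PS_plus (PS_scal (- x) (PS_incr_1 a))
                              (PS_scal alpha (PS_incr_1 (PS_incr_1 a))))).
(* The denominator equals 1 at [t = 0], so by continuity it can be cleared near 0. *)
assert (Hden : locally 0 (fun t : R => 0 < 1 - x * t + alpha * t ^ 2)).
{ assert (Hc : continuous (fun t : R => 1 - x * t + alpha * t ^ 2) 0).
    apply (ex_derive_continuous (V := R_NormedModule)); auto_derive; trivial.
  apply Hc, open_gt; lra. }
assert (Hb : locally 0 (fun t : R => is_pseries b t (2 + - x * t))).
{ generalize (filter_and _ _ Hden (HD x alpha)).
  apply filter_imp; intros t [Ht Hs].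
  set (s := (2 - x * t) / (1 - x * t + alpha * t ^ 2)) in Hs.
  replace (2 + - x * t) with (s + (- x * (t * s) + alpha * (t * (t * s)))).
  2: { unfold s; field; simpl in Ht; lra. }
  assert (Hcomm : forall c : R, mult t c = mult c t) by (intros; apply Rmult_comm).
  assert (Hs1 := is_pseries_incr_1 (V := R_NormedModule) a t s Hs).
  exact (is_pseries_plus (V := R_NormedModule) _ _ t _ _ Hs
    (is_pseries_plus _ _ t _ _
      (is_pseries_scal (- x) _ t _ (Hcomm _) Hs1)
      (is_pseries_scal alpha _ t _ (Hcomm _) (is_pseries_incr_1 _ t _ Hs1)))). }
assert (Hcoef := fun n => pseries_coef_Derive_n b _ n Hb).
(* The two lowest coefficients read [D_0 = 2] and [D_1 - x D_0 = - x]; all later ones vanish, which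
   is the recurrence. *)
assert (Hb0 := Hcoef 0%nat).
assert (Hb1 := Hcoef 1%nat).
rewrite Derive_n_affine in Hb0, Hb1.
unfold b, PS_plus, PS_scal, a in Hb0, Hb1.
unfold plus, scal, zero in Hb0, Hb1; simpl in Hb0, Hb1.
unfold mult, zero in Hb0, Hb1; simpl in Hb0, Hb1.
assert (H0 : D 0%nat x alpha = 2) by lra.
rewrite H0 in Hb1.
repeat split; [exact H0 | lra |].
intros n.
assert (Hbn := Hcoef (S (S n))).
rewrite Derive_n_affine in Hbn.
apply Rmult_integral in Hbn as [Hbn | Hbn]; [|now apply INR_fact_neq_0 in Hbn].
unfold b, PS_plus, PS_scal, a in Hbn.
unfold plus, scal in Hbn; simpl in Hbn; unfold mult in Hbn; simpl in Hbn.
lra.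
Qed.

Lemma exp_cos_family_cos_sin (Cn : nat -> R -> R -> R) (n : nat) (th : R) :
  exp_cos_family Cn -> Cn n (cos th) (sin th) = cos (INR n * th).
Proof.
intros HC.
pose (F := fun k t => exp (cos th * t) * cos (sin th * t + INR k * th)).
assert (HF : forall (k : nat) (t : R), is_derive (F k) t (F (S k) t)).
{ intros k t; unfold F; auto_derive; trivial.
  rewrite S_INR.
  (* With phase [p = sin th * t + INR k * th], the derivative has the factor
     [cos th * cos p - sin th * sin p], that is [cos (p + th)]. *)
  replace (sin th * t + (INR k + 1) * th)
    with (sin th * t + INR k * th + th) by ring.
  rewrite (cos_plus (sin th * t + INR k * th) th); ring. }
assert (Hs : locally 0 (fun t : R =>
  is_pseries (fun n => Cn n (cos th) (sin th) / INR (fact n)) t (F 0%nat t))).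
{ apply filter_forall; intros t; unfold F.
  replace (sin th * t + INR 0 * th) with (sin th * t) by (simpl; ring).
  apply HC. }
apply pseries_coef_Derive_n with (n := n) in Hs.
rewrite Derive_n_iterated in Hs by exact HF.
unfold F in Hs.
rewrite !Rmult_0_r, exp_0, Rmult_1_l, Rplus_0_l in Hs.
rewrite <- Hs; field; apply INR_fact_neq_0.
Qed.

Lemma dickson_first_kind_cos (D : nat -> R -> R -> R) (n : nat) (th : R) :
  dickson_first_kind D -> D n (2 * cos th) 1 = 2 * cos (INR n * th).
Proof.
intros HD.
destruct (dickson_rec D (2 * cos th) 1 HD) as [H0 [H1 Hrec]].
(* The recurrence has order two, so the induction carries two consecutive indices. *)
enough (H : D n (2 * cos th) 1 = 2 * cos (INR n * th) /\
            D (S n) (2 * cos th) 1 = 2 * cos (INR (S n) * th)) by apply H.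
induction n as [|n [IH1 IH2]].
  rewrite H0, H1; simpl.
  rewrite Rmult_0_l, Rmult_1_l, cos_0; split; ring.
split; [exact IH2|].
rewrite Hrec, IH1, IH2.
(* Centring at [p = INR (S n) * th] reduces the step to [cos (p + th) + cos (p - th) = 2 cos th cos
   p]. *)
replace (INR n * th) with (INR (S n) * th - th) by (rewrite S_INR; ring).
replace (INR (S (S n)) * th) with (INR (S n) * th + th) by (rewrite (S_INR (S n)); ring).
rewrite cos_plus, cos_minus; ring.
Qed.

(** [Re] is additive and continuous, so it commutes with partial sums and with their limit. *)
Lemma is_series_Re (u : nat -> C) (l : C) :
  is_series (V := C_R_NormedModule) u l ->
  is_series (fun n => Re (u n)) (Re l).
Proof.
intros H.
assert (Hsum : forall n, sum_n (fun k => Re (u k)) n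
                         = Re (sum_n (G := C_R_NormedModule) u n)).
{ induction n as [|n IH]; [now rewrite !sum_O|].
  now rewrite !sum_Sn, IH. }
unfold is_series.
apply (filterlim_ext (fun n => Re (sum_n (G := C_R_NormedModule) u n))).
  now intros n; rewrite Hsum.
apply (filterlim_comp _ _ _ _ Re _ (locally (T := C_R_NormedModule) l)); [exact H|].
(* Balls in [C_R_NormedModule] are products of balls in the coordinates, so the same [eps]
   serves. *)
intros P [eps HP]; exists eps; intros z [Hz _].
now apply HP.
Qed.

(** The real part of [exp (w t)] is [exp (Re w * t) * cos (Im w * t)], so both sides are
    coefficients of one function. *)
Lemma exp_family_Re (Cn : nat -> R -> R -> R) (N : nat -> C -> C)
    (n : nat) (w : C) :
  exp_cos_family Cn -> exp_family N -> Cn n (Re w) (Im w) = Re (N n w).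
Proof.
intros HC HN.
pose (f := fun t => exp (Re w * t) * cos (Im w * t)).
assert (Hc : locally 0 (fun t : R =>
  is_pseries (fun n => Cn n (Re w) (Im w) / INR (fact n)) t (f t))).
{ apply filter_forall; intros t; apply HC. }
assert (Hn : locally 0 (fun t : R =>
  is_pseries (fun n => Re (N n w) / INR (fact n)) t (f t))).
{ apply filter_forall; intros t.
  assert (H := is_series_Re _ _ (HN w t)).
  replace (f t) with (Re (Cexp (w * RtoC t)%C)).
    revert H; apply is_series_ext; intros k.
    assert (Hk := INR_fact_neq_0 k).
    destruct (N k w) as [p q].
    unfold scal; simpl; unfold scal; simpl; unfold mult; simpl.
    field; exact Hk.
  destruct w as [p q]; unfold f, Cexp; simpl.
  now rewrite !Rmult_0_r, Rminus_0_r, Rplus_0_l. }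
apply (pseries_coef_Derive_n _ _ n) in Hc.
apply (pseries_coef_Derive_n _ _ n) in Hn.
rewrite <- Hn in Hc.
apply Rmult_eq_reg_r in Hc; [|apply INR_fact_neq_0].
apply Rmult_eq_reg_r in Hc; [exact Hc|].
apply Rinv_neq_0_compat, INR_fact_neq_0.
Qed.

Theorem corollary35 :
  forall (D Cn : nat -> R -> R -> R) (N : nat -> C -> C),
    dickson_first_kind D ->
    exp_cos_family Cn ->
    exp_family N ->
    forall (n : nat) (x : R),
      Rabs x <= 1 ->
      D n (2 * x) 1 = 2 * Cn n x (sqrt (1 - x ^ 2)) /\
      2 * Cn n x (sqrt (1 - x ^ 2)) =
        2 * Re (N n (RtoC x + Ci * RtoC (sqrt (1 - x ^ 2)))%C).
Proof.
intros D Cn N HD HC HN n x Hx.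
apply Rabs_le_between in Hx.
split.
- replace (1 - x ^ 2) with (1 - x²) by (unfold Rsqr; ring).
  rewrite <- (sin_acos x Hx).
  (* The angle is [acos x]. Only the arguments of [D] and [Cn] are rewritten, not the [x] inside
     [acos x]. *)
  rewrite <- (cos_acos x Hx) at 1 2.
  now rewrite dickson_first_kind_cos, exp_cos_family_cos_sin.
- f_equal.
  set (y := sqrt (1 - x ^ 2)).
  rewrite <- (exp_family_Re Cn N n _ HC HN).
  f_equal; simpl; ring.
Qed.
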